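(* Let $n\ge1$ be an integer, $p$ a prime with $p\equiv1\pmod n$, and $l_1,\dots,l_s$ distinct primes, different from $p$ and not dividing $n$. Let $F=\mathbb{Q}(\zeta_n)$ with $\zeta_n$ a fixed primitive $n$-th root of unity, fix $n$-th roots $l_i^{1/n}$, and let $L=F(l_1^{1/n},\dots,l_s^{1/n})$. For $i=1,\dots,s$ let $\lambda_i\in\operatorname{Gal}(L/F)$ be the automorphism with $\lambda_i(l_i^{1/n})=\zeta_n l_i^{1/n}$ and $\lambda_i(l_j^{1/n})=l_j^{1/n}$ for $j\ne i$. Let $K_n(p)$ be the unique subfield of degree $n$ of $\mathbb{Q}(\zeta_p)$. Let $\wp$ be any prime of $F$ above $p$, and suppose the Frobenius element of $\wp$ in the abelian extension $L/F$ is $\mathrm{Fr}_{L/F}(\wp)=\lambda_1^{a_1}\cdots\lambda_s^{a_s}$. Then there is a generator $\tau$ of $\operatorname{Gal}(K_n(p)/\mathbb{Q})$ such that $\mathrm{Fr}_{K_n(p)/\mathbb{Q}}(l_i)=\tau^{a_i}$ for all $i=1,\dots,s$.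
   Context: Under these hypotheses $L/F$ is abelian with $\operatorname{Gal}(L/F)\cong\mu_n^s$, so $\operatorname{Gal}(L/F)=\langle\lambda_1\rangle\times\cdots\times\langle\lambda_s\rangle$ with each $\lambda_i$ of order $n$; $L/F$ is unramified at primes above $p$, and $K_n(p)/\mathbb{Q}$ is cyclic of degree $n$ and unramified at each $l_i$. $\mathrm{Fr}$ denotes the Frobenius automorphism. *)

(* Defs.v *)
From HB Require Import structures.
From mathcomp Require Import all_boot all_order all_algebra all_fingroup all_solvable all_field.
Set Implicit Arguments. Unset Strict Implicit. Unset Printing Implicit Defensive.
Import GRing.Theory.
Local Open Scope ring_scope.

Section NT.
Variable L : splittingFieldType rat.

Definition alg_integral (x : L) : Prop :=
  exists q : {poly int}, q \is monic /\ root (map_poly (fun c : int => c%:~R) q) x.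

Definition ringInt (E : {vspace L}) (x : L) : Prop := x \in E /\ alg_integral x.

Definition prime_ideal (E : {vspace L}) (P : L -> Prop) : Prop :=
  [/\ (forall x, P x -> ringInt E x),
      P 0,
      (forall x y, P x -> P y -> P (x + y)) &
      (forall x, P x -> P (- x))] /\
  [/\
(forall x y, ringInt E x -> P y -> P (x * y)),
      ~ P 1,
      (forall x y, ringInt E x -> ringInt E y -> P (x * y) -> P x \/ P y)
    & exists x, P x /\ x != 0].

Definition lies_over (K : {vspace L}) (P Q : L -> Prop) : Prop :=
  forall x, ringInt K x -> (P x <-> Q x).

(* the residue ring O_K / (P cap O_K) has exactly q elements *)
Definition residue_card (K : {vspace L}) (P : L -> Prop) (q : nat) : Prop :=
  exists s : seq L,
    [/\ size s = q,
        (forall x, x \in s -> ringInt K x),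
        (forall i j, (i < q)%N -> (j < q)%N -> P (s`_i - s`_j) -> i = j)
      & (forall x, ringInt K x -> exists2 y, y \in s & P (x - y))].

Definition is_frobenius (E K : {vspace L}) (P : L -> Prop) (sigma : gal_of E) : Prop :=
  sigma \in 'Gal(E / K)%g /\
  exists q : nat, residue_card K P q /\
    forall x, ringInt E x -> P (sigma x - x ^+ q).

End NT.
Arguments is_frobenius {L} E K P sigma.
Arguments prime_ideal {L} E P.
Arguments lies_over {L} K P Q.
Arguments residue_card {L} K P q.
Arguments ringInt {L} E x.

(* Main.v *)
Require Import Defs.
From HB Require Import structures.
From mathcomp Require Import all_boot all_order all_algebra all_fingroup all_solvable all_field.
From mathcomp Require Import ring.
Set Implicit Arguments. Unset Strict Implicit. Unset Printing Implicit Defensive.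
Import GRing.Theory.
Local Open Scope ring_scope.

(* For a primitive [m]-th root of unity [z], every integer [x] of [Q(z)] has
   [m x] in [Z[z]]; hence for a prime [l] not dividing [m] the automorphism
   [z |-> z^l] is congruent to [x |-> x^l] modulo any prime above [l].  With
   [m = n], [l = p] this shows that the residue field of [F] at [Pf] is [F_p];
   evaluating the Frobenius of [L/F] at [r i] then gives
   [z^(a i) = (l i)^d] modulo [Pf], where [d = (p-1)/n].  Let [c] be the
   reduction of [z], a primitive [n]-th root of unity in [F_p], and write
   [c = k0^d].  Since [Gal(Q(zp)/Q)] is cyclic of order [p-1], the restriction
   to [K] of [s_k : zp |-> zp^k] is determined by [k^d]; so [tau], the
   restriction of [s_k0], generates [Gal(K/Q)], and [(l i)^d = c^(a i)] says
   that [s_(l i)], the Frobenius at [l i], restricts to [tau^(a i)]. *)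

(** * Algebraic integers in subfields of [L] *)

Section IntegersOfSubfields.
Variable L : splittingFieldType rat.
Implicit Types (E K : {subfield L}) (x y z : L).

Lemma natr_L_eq0 (n : nat) : (n%:R == 0 :> L) = (n == 0%N).
Proof. by rewrite -(rmorph_nat (in_alg L)) fmorph_eq0 Num.Theory.pnatr_eq0. Qed.

Lemma alg_integralE x : Defs.alg_integral x <-> integralOver (intr : int -> L) x.
Proof. by split=> [[q [? ?]] | [q ? ?]]; exists q. Qed.

Lemma ringIntD E x y : ringInt E x -> ringInt E y -> ringInt E (x + y).
Proof.
move=> [Ex /alg_integralE ix] [Ey /alg_integralE iy]; split; first exact: rpredD.
by apply/alg_integralE/integral_add.
Qed.

Lemma ringIntM E x y : ringInt E x -> ringInt E y -> ringInt E (x * y).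
Proof.
move=> [Ex /alg_integralE ix] [Ey /alg_integralE iy]; split; first exact: rpredM.
by apply/alg_integralE/integral_mul.
Qed.

Lemma ringIntN E x : ringInt E x -> ringInt E (- x).
Proof.
move=> [Ex /alg_integralE ix]; split; first by rewrite rpredN.
by apply/alg_integralE/integral_opp.
Qed.

Lemma ringIntB E x y : ringInt E x -> ringInt E y -> ringInt E (x - y).
Proof. by move=> ix iy; apply/ringIntD/ringIntN. Qed.

Lemma ringInt_int E (m : int) : ringInt E m%:~R.
Proof. by split; [exact: rpred_int | apply/alg_integralE/integral_id]. Qed.

Lemma ringInt_nat E (m : nat) : ringInt E m%:R.
Proof. by rewrite pmulrn; exact: ringInt_int. Qed.

Lemma ringInt_sum E (I : Type) (s : seq I) (P : pred I) (f : I -> L) :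
  (forall i, P i -> ringInt E (f i)) -> ringInt E (\sum_(i <- s | P i) f i).
Proof.
move=> fP; apply: (big_ind (ringInt E)) => //; last exact: ringIntD.
exact: (ringInt_int E 0).
Qed.

Lemma ringIntX E x m : ringInt E x -> ringInt E (x ^+ m).
Proof.
move=> ix; elim: m => [|m IHm]; first exact: (ringInt_int E 1).
by rewrite exprS; apply: ringIntM.
Qed.

Lemma ringInt_horner E x (g : {poly int}) :
  ringInt E x -> ringInt E (map_poly intr g).[x].
Proof.
move=> ix; rewrite horner_poly; apply: ringInt_sum => i _.
by apply: ringIntM; [exact: ringInt_int | exact: ringIntX].
Qed.

Lemma ringInt_root E x m (c : nat) :
  (0 < m)%N -> x \in E -> x ^+ m = c%:R -> ringInt E x.
Proof.
move=> m_gt0 Ex xm; split=> //; exists ('X^m - c%:R%:P); split.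
  exact: monicXnsubC.
rewrite /root rmorphB /= map_polyXn map_polyC /= !hornerE xm.
by rewrite -(rmorph_nat intr) subrr.
Qed.

Lemma ringIntS E K x : (E <= K)%VS -> ringInt E x -> ringInt K x.
Proof. by move=> /subvP sEK [/sEK]. Qed.

Lemma ringInt_gal E (s : gal_of E) x : ringInt E x -> ringInt E (s x).
Proof.
move=> [Ex [q [mq qx]]]; split; first exact: memv_gal.
exists q; split=> //; have := rmorph_root (gal_repr s) qx.
rewrite -map_poly_comp; congr (is_true (root _ _)).
by apply: eq_map_poly => c /=; rewrite rmorph_int.
Qed.

(** An integral element of the prime field is carried into [algC], where a rational algebraic
    integer is known to lie in Z. *)
Lemma ringInt1P x : ringInt 1%VS x -> exists m : int, x = m%:~R.
Proof.
case=> /vlineP[c ->] [q [mq]]; rewrite -[c *: 1]/(in_alg L c).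
have ->: map_poly (fun c => c%:~R) q = map_poly (in_alg L) (map_poly intr q).
  rewrite -map_poly_comp; apply: eq_map_poly => a.
  exact/esym/(rmorph_int (in_alg L)).
rewrite fmorph_root => /(rmorph_root (ratr : {rmorphism rat -> algC})) qc.
have /(Cint_rat_Aint (Crat_rat c))/Num.Theory.intrP[m cm] : ratr c \in Aint.
  apply: (root_monic_Aint qc).
    by rewrite map_monic (monic_map _ mq).
  apply/polyOverP=> i; rewrite !coef_map /= rmorph_int.
  exact: Num.Theory.intr_int.
exists m; move: cm; rewrite -(rmorph_int (ratr : {rmorphism rat -> algC})).
by move/fmorph_inj->; exact: (rmorph_int (in_alg L)).
Qed.

Lemma galois_adjoin_prim_root n z : n.-primitive_root z -> galois 1 <<1; z>>.
Proof.
move=> prim_z; have n_gt0 := prim_order_gt0 prim_z.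
apply/splitting_galoisField; exists ('X^n - 1); split.
- by rewrite rpredB ?rpredX ?polyOverX ?rpred1.
- by apply: separable_Xn_sub_1; rewrite natr_L_eq0 -lt0n.
exists [seq z ^+ i | i <- index_iota 0 n].
  by rewrite big_map -(factor_Xn_sub_1 prim_z) eqpxx.
apply/eqP; rewrite eqEsubv; apply/andP; split.
  apply/Fadjoin_seqP; split; first exact: subv_adjoin.
  by move=> _ /mapP[i _ ->]; rewrite rpredX ?memv_adjoin.
apply/FadjoinP; split; first exact: subv_adjoin_seq.
(* The exponent is reduced modulo [n] to include [n = 1], where 0 is the only index. *)
apply: seqv_sub_adjoin; apply/mapP; exists (1 %% n)%N.
  by rewrite mem_index_iota ltn_mod.
by rewrite prim_expr_mod.
Qed.

Lemma sum_unity_root_expr n (w : L) :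
  w ^+ n = 1 -> \sum_(i < n) w ^+ i = if w == 1 then n%:R else 0.
Proof.
move=> wn; case: eqP => [-> | /eqP w1].
  by under eq_bigr do rewrite expr1n; rewrite sumr_const card_ord.
by have /esym/eqP := subrX1 w n; rewrite wn subrr mulf_eq0 subr_eq0 (negPf w1) => /eqP.
Qed.

(* [n x = \sum_(i < n) Tr (x z^-i) z^i], because [\sum_(i < n) (z / s z)^i]
   vanishes for every automorphism [s] other than the identity. *)
Lemma natr_mul_ringInt_prim_root n z x :
    n.-primitive_root z -> ringInt <<1; z>>%VS x ->
  exists g : {poly int}, n%:R * x = (map_poly intr g).[z].
Proof.
move=> prim_z ix; have galE := galois_adjoin_prim_root prim_z.
set E := <<1; z>>%AS in ix galE.
have n_gt0 := prim_order_gt0 prim_z; have zn := prim_expr_order prim_z.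
have z_neq0 : z != 0 by rewrite -(unitfE z) -(unitrX_pos _ n_gt0) zn unitr1.
have Ez : z \in E by exact: memv_adjoin.
have iz : ringInt E z^-1.
  by apply: (@ringInt_root _ _ n 1 n_gt0); rewrite ?rpredV // exprVn zn invr1.
(* These traces are the coefficients of [g]; each is integral and rational, hence in Z. *)
have trP (i : nat) : exists m : int, galTrace 1 E (x * z^-1 ^+ i) == m%:~R.
  have [|m ->] := @ringInt1P (galTrace 1 E (x * z^-1 ^+ i)); last by exists m.
  have ixz : ringInt E (x * z^-1 ^+ i) by apply/ringIntM/ringIntX.
  split; first by apply: mem_galTrace => //; case: ixz.
  by have [] : ringInt E (galTrace 1 E (x * z^-1 ^+ i));
     first by apply: ringInt_sum => s _; apply: ringInt_gal.
pose c i := xchoose (trP i).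
exists (\poly_(i < n) c i).
have ->: (map_poly intr (\poly_(i < n) c i)).[z]
   = \sum_(i < n) galTrace 1 E (x * z^-1 ^+ i) * z ^+ i.
  rewrite (@horner_coef_wide _ n).
    apply: eq_bigr => i _; rewrite coef_map coef_poly ltn_ord /=.
    by rewrite -(eqP (xchooseP (trP i))).
  by apply: leq_trans (size_poly _ _) (size_poly _ _).
under eq_bigr => i _ do rewrite mulr_suml.
rewrite exchange_big (bigD1 1%g) ?group1 //= [X in _ + X]big1 ?addr0 => [|s /andP[Gs s1]].
  under eq_bigr => i _ do rewrite gal_id -mulrA -exprMn mulVf // expr1n mulr1.
  by rewrite sumr_const card_ord mulr_natl.
under eq_bigr => i _ do rewrite rmorphM rmorphXn fmorphV -mulrA -exprMn.
rewrite -mulr_sumr sum_unity_root_expr; last first.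
  by rewrite exprMn exprVn -rmorphXn zn rmorph1 invr1 mulr1.
rewrite ifN ?mulr0 //; apply: contra s1 => /eqP szz.
rewrite (gal_adjoin_eq Gs (group1 _)) gal_id.
by apply/eqP; rewrite -[LHS]mulr1 -szz mulrA mulfV ?mul1r // fmorph_eq0.
Qed.

End IntegersOfSubfields.

(** * Integers and integral polynomials modulo [p] *)

Section ReductionModP.
Variable p : nat.
Hypothesis p_pr : prime p.

Lemma natr_Fp_eq0 (m : nat) : (m%:R == 0 :> 'F_p) = (p %| m)%N.
Proof. by rewrite (dvdn_pcharf (pchar_Fp p_pr)). Qed.

Lemma intr_Fp_eq0 (m : int) : (m%:~R == 0 :> 'F_p) = (p %| m)%Z.
Proof.
case: (intP m) => [|k|k]; first by rewrite eqxx dvdz0.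
  by rewrite (natr_Fp_eq0 k.+1).
by rewrite rmorphN oppr_eq0 (natr_Fp_eq0 k.+1) dvdzE abszN.
Qed.

Lemma eqr_nat_Fp (a b : nat) : (a%:R == b%:R :> 'F_p) = (a == b %[mod p]).
Proof.
by rewrite -val_eqE /= !val_Fp_nat.
Qed.

Lemma map_poly_Fp_eq0 (G : {poly int}) :
  map_poly (intr : int -> 'F_p) G = 0 -> exists h, G = p%:Z *: h.
Proof.
move=> G0; exists (map_poly (fun c => (c %/ p)%Z) G); apply/polyP => i.
rewrite coefZ coef_map_id0 ?div0z // mulrC divzK // -intr_Fp_eq0.
by rewrite -coef_map G0 coef0.
Qed.

Lemma poly_Fp_expp (G : {poly 'F_p}) : G ^+ p = G \Po 'X^p.
Proof.
have chp : p \in [pchar {poly 'F_p}] by rewrite pchar_poly pchar_Fp.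
elim/poly_ind: G => [|G c IHG]; first by rewrite comp_poly0 expr0n -[p]prednK ?prime_gt0.
rewrite exprDn_pchar ?pnatE ?prime_gt0 // comp_polyD comp_polyM comp_polyX comp_polyC.
have cp : c ^+ p = c by have := expf_card c; rewrite card_Fp.
by rewrite exprMn IHG -rmorphXn /= cp.
Qed.

(** Lifting the Frobenius identity to Z[X] with an explicit multiple of [p] lets it be evaluated at
    an algebraic integer. *)
Lemma poly_int_expp (g : {poly int}) : exists h, g ^+ p - (g \Po 'X^p) = p%:Z *: h.
Proof.
apply: map_poly_Fp_eq0; rewrite rmorphB rmorphXn /= map_comp_poly map_polyXn.
by rewrite poly_Fp_expp subrr.
Qed.

(** Lift of the factorisation of X^p - X over F_p; it will show that an integer fixed by the p-th
    power modulo a prime ideal is congruent to a natural number. *)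
Lemma poly_int_prod_XsubC :
  exists h, 'X^p - 'X - \prod_(k : 'F_p) ('X - (k : nat)%:R%:P) = p%:Z *: h :> {poly int}.
Proof.
apply: map_poly_Fp_eq0; rewrite !rmorphB rmorph_prod /= map_polyXn map_polyX.
have := finField_genPoly 'F_p; rewrite card_Fp // => ->.
apply/eqP; rewrite subr_eq0; apply/eqP/eq_bigr => k _.
by rewrite rmorphB /= map_polyX map_polyC /= rmorph_nat natr_Zp.
Qed.

Lemma int_expp_congr (m : int) : exists t : int, m ^+ p = m + p%:Z * t.
Proof.
suff /dvdzP[t mt] : (p %| m ^+ p - m)%Z by exists t; rewrite mulrC -mt addrC subrK.
rewrite -intr_Fp_eq0 // rmorphB rmorphXn /=.
by have := expf_card (m%:~R : 'F_p); rewrite card_Fp // => ->; rewrite subrr.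
Qed.

Lemma Fp_expr_pred (x : 'F_p) : x != 0 -> x ^+ p.-1 = 1.
Proof.
move=> x0; apply: (mulfI x0); rewrite mulr1 -exprS prednK ?prime_gt0 //.
by have := expf_card x; rewrite card_Fp.
Qed.

Lemma Fp_prim_root_exists : exists w : 'F_p, (p.-1).-primitive_root w.
Proof.
have /hasP[w _] : has (p.-1).-primitive_root [seq x <- enum 'F_p | x != 0].
  apply: has_prim_root.
  - by rewrite -subn1 subn_gt0 prime_gt1.
  - apply/allP=> x; rewrite mem_filter unity_rootE => /andP[x0 _].
    by rewrite Fp_expr_pred.
  - by rewrite filter_uniq ?enum_uniq.
  have := cardC1 (0 : 'F_p); rewrite card_Fp // => <-.
  by rewrite cardE /enum_mem -filter_predI; apply: eq_leq; congr (size _);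
     apply: eq_filter => x; rewrite /= !inE andbT.
by exists w.
Qed.

(** With [w] a primitive root modulo [p] and [c = w^j], the relation [c^n = 1] gives [d n | j n], so
    [d | j] and [w^(j/d)] is a [d]-th root of [c]. *)
Lemma Fp_unity_root_expr n d (c : 'F_p) :
  (p.-1 = d * n)%N -> (0 < n)%N -> c ^+ n = 1 -> exists k : nat, k%:R ^+ d = c.
Proof.
move=> pdn n_gt0 cn; have [w prim_w] := Fp_prim_root_exists.
have [|[j /= _] cj] := prim_rootP prim_w (x := c).
  by rewrite pdn mulnC exprM cn expr1n.
have /dvdnP[i ji] : (d %| j)%N.
  have := cn; rewrite cj -exprM => /eqP; rewrite -(prim_order_dvd prim_w) pdn.
  by rewrite dvdn_pmul2r.
by exists (w ^+ i); rewrite natr_Zp -exprM -ji.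
Qed.

End ReductionModP.

(** * Congruences modulo a prime ideal, and residue rings *)

Section PrimeIdeals.
Variables (L : splittingFieldType rat) (E : {subfield L}) (P : L -> Prop).
Hypothesis P_pr : prime_ideal E P.
Implicit Types x y : L.

Let PD x y : P x -> P y -> P (x + y). Proof. by case: P_pr => -[_ _ + _] _; apply. Qed.
Let PN x : P x -> P (- x). Proof. by case: P_pr => -[_ _ _ +] _; apply. Qed.
Let PM x y : ringInt E x -> P y -> P (x * y). Proof. by case: P_pr => _ [+ _ _ _]; apply. Qed.
Let P1 : ~ P 1. Proof. by case: P_pr => _ []. Qed.
Let Ppr x y : ringInt E x -> ringInt E y -> P (x * y) -> P x \/ P y.
Proof. by case: P_pr => _ [_ _ + _]; apply. Qed.

Lemma prime_idealB x y : P x -> P y -> P (x - y).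
Proof. by move=> Px Py; apply/PD/PN. Qed.

Lemma prime_idealBC x y : P (x - y) -> P (y - x).
Proof. by move/PN; rewrite opprB. Qed.

Lemma prime_ideal_trans x y z : P (x - y) -> P (y - z) -> P (x - z).
Proof. by move=> Pxy /(PD Pxy); rewrite addrA subrK. Qed.

Lemma prime_idealXB x y m :
  ringInt E x -> ringInt E y -> P (x - y) -> P (x ^+ m - y ^+ m).
Proof.
move=> ix iy Pxy; rewrite subrXX mulrC; apply: PM Pxy.
by apply: ringInt_sum => i _; apply: ringIntM; apply: ringIntX.
Qed.

Lemma prime_ideal_prod (I : Type) (s : seq I) (f : I -> L) :
  (forall i, ringInt E (f i)) -> P (\prod_(i <- s) f i) -> exists i, P (f i).
Proof.
move=> fP; elim: s => [|i s IHs]; first by rewrite big_nil => /P1.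
have is_ : ringInt E (\prod_(j <- s) f j).
  by apply: (big_ind (ringInt E)) => //; [exact: (ringInt_int E 1) | exact: ringIntM].
by rewrite big_cons => /(Ppr (fP i) is_)[Pi | /IHs //]; exists i.
Qed.

Variable p : nat.
Hypotheses (p_pr : prime p) (Pp : P p%:R).

Lemma prime_ideal_natM x : ringInt E x -> P (p%:R * x).
Proof. by move=> ix; rewrite mulrC; apply: PM. Qed.

(** If [p] did not divide [m], a Bezout relation would put 1 in [P]. *)
Lemma prime_ideal_intP (m : int) : P m%:~R <-> (p %| m)%Z.
Proof.
split=> [Pm | /dvdzP[k ->]]; last first.
  by rewrite rmorphM /=; apply: PM => //; exact: ringInt_int.
apply/negPn/negP=> pm; apply: P1.
have /coprimezP[[u v] /= uv1] : coprimez p m by rewrite coprimezE prime_coprime.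
have ->: 1 = u%:~R * p%:R + v%:~R * m%:~R :> L by rewrite pmulrn -!rmorphM -rmorphD uv1.
by apply: PD; apply: PM => //; exact: ringInt_int.
Qed.

Lemma prime_ideal_natP (m : nat) : P m%:R <-> (p %| m)%N.
Proof. exact: (prime_ideal_intP m). Qed.

Lemma prime_ideal_natBP (a b : nat) : P (a%:R - b%:R) <-> a%:R = b%:R :> 'F_p.
Proof.
have ->: a%:R - b%:R = (a%:Z - b%:Z)%:~R :> L by rewrite rmorphB.
apply: (iff_trans (prime_ideal_intP _)).
by rewrite -intr_Fp_eq0 // rmorphB /= subr_eq0; split=> /eqP.
Qed.

(** The product of the [x - k] over all residues [k] is congruent to [x^p - x], so it lies in [P],
    and primality selects a factor. *)
Lemma prime_ideal_expp_congr x :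
  ringInt E x -> P (x ^+ p - x) -> exists k : nat, P (x - k%:R).
Proof.
move=> ix Px.
have [h /(congr1 (fun g => (map_poly intr g : {poly L}).[x]))] :=
  poly_int_prod_XsubC p_pr.
rewrite !rmorphB /= map_polyXn map_polyX map_polyZ rmorph_prod /= !hornerE.
rewrite horner_prod => hx.
have [||k Pk] := @prime_ideal_prod _ (index_enum 'F_p) (fun k => x - (k : nat)%:R).
- by move=> k; apply/ringIntB/ringInt_nat.
- have -> : \prod_(k : 'F_p) (x - (k : nat)%:R)
     = x ^+ p - x - p%:R * (map_poly intr h).[x].
    rewrite -hx opprB addrC subrK; apply: eq_bigr => k _.
    by rewrite rmorphB /= map_polyX map_polyC /= rmorph_nat !hornerE.
  apply: prime_idealB => //; apply: prime_ideal_natM.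
  exact: ringInt_horner.
by exists (k : nat).
Qed.

Lemma residue_card_prime (K : {subfield L}) :
    (forall x, ringInt K x -> exists k : int, P (x - k%:~R)) ->
  residue_card K P p.
Proof.
move=> KP; exists [seq k%:R | k <- iota 0 p]; split.
- by rewrite size_map size_iota.
- by move=> _ /mapP[k _ ->]; apply: ringInt_nat.
- move=> i j lt_ip lt_jp; rewrite !(nth_map 0%N) ?size_iota // !nth_iota //.
  move/prime_ideal_natBP/eqP; rewrite eqr_nat_Fp //.
  by rewrite !modn_small // => /eqP.
move=> x /KP[k Pk].
have p_neq0 : p%:Z != 0 by rewrite eqz_nat -lt0n prime_gt0.
have [j kp] : exists j : nat, (k %% p)%Z = j.
  by exists (absz (k %% p)%Z); rewrite gez0_abs ?modz_ge0.
exists j%:R.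
  apply: map_f; rewrite mem_iota /= add0n -ltz_nat -kp.
  by rewrite ltz_pmod // ltz_nat prime_gt0.
apply: (prime_ideal_trans Pk); rewrite (pmulrn 1 j) -rmorphB; apply/prime_ideal_intP.
by rewrite -kp {1}(divz_eq k p) addrK dvdz_mull.
Qed.

End PrimeIdeals.

(** Since [is_frobenius] only asserts that some cardinality [q] exists, uniqueness is what
    identifies it. Matching congruent representatives injects one system into the other. *)
Lemma residue_card_uniq (L : splittingFieldType rat) (E K : {subfield L})
    (P : L -> Prop) q q' :
  prime_ideal E P -> residue_card K P q -> residue_card K P q' -> q = q'.
Proof.
move=> P_pr.
suff le q1 q2 : residue_card K P q1 -> residue_card K P q2 -> (q1 <= q2)%N.
  by move=> cq cq'; apply/eqP; rewrite eqn_leq !le.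
case=> [s [sz_s sK s_inj _]] [t [sz_t _ _ tP]].
have /fin_all_exists[f fP] (i : 'I_q1) : exists j : 'I_q2, P (s`_i - t`_j).
  have [|y] := tP s`_i; first by apply/sK/mem_nth; rewrite sz_s.
  move=> ty Py; have lt_j : (index y t < q2)%N by rewrite -sz_t index_mem.
  by exists (Ordinal lt_j); rewrite /= nth_index.
rewrite -(card_ord q1) -(card_ord q2); apply: (leq_card f) => i j fij.
apply: val_inj; apply: s_inj; rewrite ?ltn_ord //=; apply: (prime_ideal_trans P_pr (fP i)).
by rewrite fij; apply/(prime_idealBC P_pr)/fP.
Qed.

(** * The Frobenius congruence in cyclotomic fields *)

Section CyclotomicFrobenius.
Variable L : splittingFieldType rat.
Implicit Types x z : L.

(** Write [m x = g(z)] with [g] in Z[X]. Modulo [l], [m s(x) = g(z^l)] is congruent to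
    [g(z)^l = m^l x^l], and [m^l] to [m]. The factor [m] is cancelled later, modulo primes not
    containing it. *)
Lemma prim_root_frobenius_congr m l z (s : gal_of <<1; z>>) x :
    m.-primitive_root z -> prime l -> s z = z ^+ l -> ringInt <<1; z>>%VS x ->
  exists2 y, ringInt <<1; z>>%VS y & m%:R * (s x - x ^+ l) = l%:R * y.
Proof.
move=> prim_z l_pr sz ix; have m_gt0 := prim_order_gt0 prim_z.
have [g gx] := natr_mul_ringInt_prim_root prim_z ix.
have iz : ringInt <<1; z>>%AS z.
  by apply: (@ringInt_root _ _ _ m 1) => //; rewrite ?memv_adjoin ?prim_expr_order.
have gsx : m%:R * s x = (map_poly intr g).[z ^+ l].
  rewrite -sz -(rmorph_nat s) -rmorphM gx -horner_map -map_poly_comp /=.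
  by congr (_.[_]); apply: eq_map_poly => c /=; rewrite rmorph_int.
have [h /(congr1 (fun g => (map_poly intr g : {poly L}).[z]))] := poly_int_expp l_pr g.
rewrite rmorphB rmorphXn /= map_comp_poly map_polyXn map_polyZ !hornerE.
rewrite horner_comp !hornerE -gx -gsx => hz.
have [t /(congr1 (intr : int -> L))] := int_expp_congr l_pr m%:Z.
rewrite rmorphD rmorphM rmorphXn /= -!pmulrn => mt.
(* Here [m^l = m + l t] and [g^l - g(X^l) = l h]; the witness collects the two multiples of [l]. *)
exists (t%:~R * x ^+ l - (map_poly intr h).[z]).
  apply: (@ringIntB _ <<1; z>>%AS); last exact: ringInt_horner.
  by apply: ringIntM; [exact: ringInt_int | exact: ringIntX].
rewrite mulrBr mulrBr -[l%:R * _.[_]]hz exprMn mt; ring.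
Qed.

End CyclotomicFrobenius.

(** * The Galois group of Q(zeta_p) and its subfields *)

Section PrimeCyclotomic.
Variables (L : splittingFieldType rat) (p : nat) (z : L).
Hypotheses (p_pr : prime p) (prim_z : p.-primitive_root z).
Let M := <<1; z>>%AS.
Let G := 'Gal(M / 1)%G.

Lemma root_Cyclotomic_prime_exp k :
  ~~ (p %| k)%N -> root (map_poly intr ('Phi_p)) (z ^+ k).
Proof.
move=> pk; have zk1 : z ^+ k != 1 by rewrite -(prim_order_dvd prim_z).
have Phi1 : 'Phi_1 = 'X - 1 by have := @prod_Cyclotomic 1 isT; rewrite big_seq1.
have dp : perm_eq (divisors p) [:: 1%N; p].
  apply: uniq_perm => [||m]; first exact: divisors_uniq.
    by rewrite /= inE neq_ltn prime_gt1.
  rewrite -dvdn_divisors ?prime_gt0 // !inE; apply/idP/idP=> [|/orP[]/eqP->] //.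
  by case/primeP: p_pr => _; apply.
have /(congr1 (fun g => (map_poly intr g : {poly L}).[z ^+ k])) :=
  prod_Cyclotomic (prime_gt0 p_pr).
rewrite (perm_big _ dp) /= !big_cons big_nil mulr1 Phi1.
rewrite rmorphM !rmorphB /= map_polyXn map_polyX rmorph1 !hornerE.
rewrite exprAC (prim_expr_order prim_z) expr1n subrr => /eqP.
by rewrite mulf_eq0 subr_eq0 (negPf zk1).
Qed.

(** This is the irreducibility of ['Phi_p] over Q, taken from the minimal polynomial of a primitive
    root [w] in [algC] and transferred to [L] through rational coefficients. *)
Lemma root_minPoly_prime_prim_root k :
  ~~ (p %| k)%N -> root (minPoly 1 z) (z ^+ k).
Proof.
move=> pk; have [w prim_w] := C_prim_root_exists (prime_gt0 p_pr).
have [q qE] := polyOver1P (minPolyOver 1 z).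
have [Phi [PhiE Phi_monic] PhiP] := minCpolyP w.
have Phi_int : Phi = map_poly intr ('Phi_p).
  apply: (map_poly_inj (ratr : {rmorphism rat -> algC})).
  rewrite -PhiE (minCpoly_cyclotomic prim_w) -(Cintr_Cyclotomic prim_w).
  by rewrite -map_poly_comp; apply: eq_map_poly => c /=; rewrite rmorph_int.
have PhiL : map_poly (in_alg L) Phi = map_poly intr ('Phi_p).
  rewrite Phi_int -map_poly_comp; apply: eq_map_poly => c.
  exact: (rmorph_int (in_alg L)).
have zP : root (map_poly (in_alg L) Phi) z.
  rewrite PhiL -[z]expr1; apply: root_Cyclotomic_prime_exp.
  by rewrite dvdn1 neq_ltn prime_gt1 ?orbT.
have : minPoly 1 z %| map_poly (in_alg L) Phi.
  by apply: minPoly_dvdp => //; apply/polyOver1P; exists Phi.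
rewrite qE dvdp_map => /dvdpP[h hE].
have : root (map_poly ratr (h * q)) w by rewrite -hE PhiP dvdpp.
(* In [Phi = h * q], one factor vanishes at [w] and so is a multiple of [Phi]. If it is [h], then
   [q] is a unit, contradicting [q(z) = 0]; if it is [q], every root of [Phi] is a root of [q]. *)
rewrite rmorphM rootM !PhiP => /orP[|] /dvdpP[u uE].
  have uq1 : u * q = 1.
    by apply: (mulIf (monic_neq0 Phi_monic)); rewrite mul1r {2}hE uE; ring.
  have := root_minPoly 1 z; rewrite qE => /rootP qz.
  have /(congr1 (fun g => (map_poly (in_alg L) g).[z])) := uq1.
  rewrite rmorphM rmorph1 hornerM qz mulr0 hornerC => /esym/eqP.
  by rewrite oner_eq0.
by rewrite uE rmorphM /= rootM PhiL root_Cyclotomic_prime_exp // orbT.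
Qed.

Lemma gal_prime_prim_root_exists k :
  ~~ (p %| k)%N -> exists2 s, s \in G & s z = z ^+ k.
Proof.
move=> pk; have /and3P[sub _ nrm] := galois_adjoin_prim_root prim_z.
apply: (normalField_root_minPoly sub nrm (memv_adjoin _ _)).
exact: root_minPoly_prime_prim_root.
Qed.

Lemma gal_prime_prim_rootP (s : gal_of M) :
  exists2 k : nat, ~~ (p %| k)%N & s z = z ^+ k.
Proof.
have : (s z) ^+ p = 1 by rewrite -rmorphXn prim_expr_order // rmorph1.
case/(prim_rootP prim_z)=> k szk; exists (k : nat) => //.
rewrite (prim_order_dvd prim_z) -szk fmorph_eq1.
by have := prim_order_dvd prim_z 1; rewrite expr1 => <-; rewrite dvdn1 neq_ltn prime_gt1 ?orbT.
Qed.

Lemma galX_prime_prim_root (s : gal_of M) k j :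
  s z = z ^+ k -> (s ^+ j)%g z = z ^+ (k ^ j).
Proof.
move=> sz; elim: j => [|j IHj]; first by rewrite gal_id.
by rewrite expgSr galM ?memv_adjoin // IHj rmorphXn /= sz -exprM expnS.
Qed.

Lemma eq_prime_prim_root_exp (a b : nat) :
  (z ^+ a == z ^+ b) = (a%:R == b%:R :> 'F_p).
Proof. by rewrite (eq_prim_root_expr prim_z) eqr_nat_Fp. Qed.

(** For a primitive root [w] modulo [p], the automorphism [z |-> z^w] generates, and its powers are
    trivial exactly when those of [w] are. *)
Lemma gal_prime_prim_root_cyclic : cyclic G /\ #|G| = p.-1.
Proof.
have [w prim_w] := Fp_prim_root_exists p_pr.
have w_neq0 : w != 0.
  rewrite -unitfE -(unitrX_pos _ (prim_order_gt0 prim_w)).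
  by rewrite (prim_expr_order prim_w) unitr1.
have [|s Gs sz] := @gal_prime_prim_root_exists w.
  by rewrite -natr_Fp_eq0 // natr_Zp.
have GE : G :=: <[s]>%g.
  apply/eqP; rewrite eqEsubset cycle_subG Gs andbT; apply/subsetP=> t Gt.
  have [k pk tz] := gal_prime_prim_rootP t.
  have [|i ki] := prim_rootP prim_w (x := k%:R).
    by rewrite Fp_expr_pred ?natr_Fp_eq0.
  apply/cycleP; exists i; apply/eqP; rewrite (gal_adjoin_eq Gt) ?groupX //.
  by rewrite tz (galX_prime_prim_root _ sz) eq_prime_prim_root_exp ki natrX natr_Zp.
split; first by rewrite GE cycle_cyclic.
rewrite GE -orderE; apply/eqP; rewrite eqn_dvd order_dvdn (prim_order_dvd prim_w).
have sX j : (s ^+ j == 1)%g = (w ^+ j == 1).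
  rewrite (gal_adjoin_eq _ (group1 _)) ?groupX // gal_id (galX_prime_prim_root _ sz).
  by rewrite -[X in _ == X]expr1 eq_prime_prim_root_exp natrX natr_Zp.
by rewrite -[w ^+ _ == 1]sX expg_order sX (prim_expr_order prim_w) !eqxx.
Qed.

Variable K : {subfield L}.
Hypothesis sKM : (K <= M)%VS.

(** The exponent [p.-1 %/ \dim K] is the order of ['Gal(M / K)]. In a cyclic group the subgroup of
    order [d] contains every element killed by [d], so [s^d = t^d] forces [s t^-1] to fix [K]. *)
Lemma gal_prime_prim_root_eq_in (s t : gal_of M) (a b : nat) :
    s \in G -> t \in G -> s z = z ^+ a -> t z = z ^+ b ->
    a%:R ^+ (p.-1 %/ \dim K) = b%:R ^+ (p.-1 %/ \dim K) :> 'F_p ->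
  {in K, s =1 t}.
Proof.
have galM1 := galois_adjoin_prim_root prim_z.
have [cycG cardG] := gal_prime_prim_root_cyclic.
set d := (_ %/ _)%N => Gs Gt sz tz abd x Kx.
have dimM : \dim M = p.-1.
  by have := galois_dim galM1; rewrite dimv1 divn1 -cardG.
have sHG : 'Gal(M / K)%G \subset G by apply: galS; apply: sub1v.
have cardH : #|'Gal(M / K)%G| = d.
  by rewrite -galois_dim ?dimM //; apply: (galoisS _ galM1); rewrite sub1v sKM.
have /fixed_gal fixH : (s * t^-1)%g \in 'Gal(M / K)%g.
  rewrite -cycle_subG -(cardSg_cyclic cycG _ sHG) ?cycle_subG ?groupM ?groupV //.
  rewrite cardH -orderE order_dvdn expgMn; last first.
    by apply: (centsP (cyclic_abelian cycG)); rewrite ?groupV.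
  suff -> : (s ^+ d = t ^+ d)%g by rewrite expVgn mulgV.
  apply/eqP; rewrite (gal_adjoin_eq (groupX _ Gs) (groupX _ Gt)).
  rewrite (galX_prime_prim_root _ sz) (galX_prime_prim_root _ tz).
  by rewrite eq_prime_prim_root_exp !natrX abd.
by rewrite -[s](mulgKV t) galM ?(subvP sKM) // fixH.
Qed.

(** [K] is the fixed field of a subgroup of an abelian group, hence of a normal one. *)
Lemma galois_sub_prime_cyclotomic : galois 1 K.
Proof.
have galM1 := galois_adjoin_prim_root prim_z.
have [cycG _] := gal_prime_prim_root_cyclic.
have galMK : galois K M by apply: (galoisS _ galM1); rewrite sub1v sKM.
rewrite -(galois_fixedField galMK); apply: (normal_fixedField_galois galM1).
by rewrite -sub_abelian_normal ?cyclic_abelian // galS ?sub1v.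
Qed.

End PrimeCyclotomic.

(** * Restriction of automorphisms and their action on radicals *)

Section GaloisAction.
Variable L : splittingFieldType rat.

(** Normality makes [K] stable under [s]. As [gal_of K] and [gal_of M] are different types,
    restriction is expressed as agreement on [K]. *)
Lemma gal_restrict (K M : {subfield L}) (s : gal_of M) :
    (K <= M)%VS -> galois 1 K -> s \in 'Gal(M / 1)%g ->
  exists2 t : gal_of K, t \in 'Gal(K / 1)%g & {in K, t =1 s}.
Proof.
move=> sKM /and3P[_ _ nK]; rewrite gal_kAut ?sub1v // => /normalField_kAut sK.
have [|t Gt ts] := kAut_to_gal (sK K _ nK); first by rewrite sub1v sKM.
by exists t => // x Kx; rewrite ts.
Qed.

Lemma gal_expg_eq_in (K M : {subfield L}) (t : gal_of K) (s : gal_of M) j :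
  (K <= M)%VS -> {in K, t =1 s} -> {in K, (t ^+ j)%g =1 (s ^+ j)%g}.
Proof.
move=> sKM ts; elim: j => [|j IHj] x Kx; first by rewrite !gal_id.
by rewrite !expgSr !galM ?(subvP sKM) // -IHj // ts ?memv_gal.
Qed.

Lemma gal_prod_kummer (F E : {subfield L}) s (z : L) (r : 'I_s -> L)
    (lam : 'I_s -> gal_of E) (a : 'I_s -> nat) :
    (F <= E)%VS -> z \in F -> (forall i, r i \in E) ->
    (forall i, lam i \in 'Gal(E / F)%g) ->
    (forall i j, lam i (r j) = if j == i then z * r j else r j) ->
  forall j, (\prod_(i < s) lam i ^+ a i)%g (r j) = z ^+ a j * r j.
Proof.
move=> sFE Fz Er lamG lamr j.
have lamX i m : (lam i ^+ m)%g (r j) = (if j == i then z ^+ m else 1) * r j.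
  elim: m => [|m IHm]; first by rewrite gal_id if_same mul1r.
  rewrite expgS galM // lamr; case: eqP IHm => [ji IHm | _ -> //].
  by rewrite rmorphM /= (fixed_gal sFE (groupX _ (lamG i)) Fz) IHm exprS mulrA.
(* For the induction the product runs over any duplicate-free list: [j] then contributes at most
   once, and the factor [z^(a j)] in [F] is fixed by the remaining automorphisms. *)
suff prodE (t : seq 'I_s) : uniq t ->
    (\prod_(i <- t) lam i ^+ a i)%g (r j) = (if j \in t then z ^+ a j else 1) * r j.
  by rewrite prodE ?index_enum_uniq // mem_index_enum.
elim: t => [|i t IHt] /=; first by rewrite big_nil gal_id mul1r.
case/andP=> it ut; rewrite big_cons galM // lamX inE.
have tG : (\prod_(i <- t) lam i ^+ a i)%g \in 'Gal(E / F)%g.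
  by apply: group_prod => k _; rewrite groupX.
have Fza m : z ^+ m \in F by rewrite rpredX.
rewrite rmorphM /= (fixed_gal sFE tG); last by case: ifP; rewrite ?Fza ?rpred1.
rewrite IHt //; case: eqP => [-> | _] /=; last by rewrite mul1r.
by rewrite (negPf it) mul1r.
Qed.

End GaloisAction.

(** * The residue field of Q(zeta_n) at a prime above [p] *)

Section ResidueField.
Variables (L : splittingFieldType rat) (n p : nat) (z : L) (P : L -> Prop).
Hypotheses (n_gt0 : (0 < n)%N) (p_pr : prime p) (pn1 : (p = 1 %[mod n])%N).
Hypotheses (prim_z : n.-primitive_root z) (P_pr : prime_ideal <<1; z>>%VS P) (Pp : P p%:R).
Let F := <<1; z>>%AS.

Lemma dvdn_pred_prime : (n %| p.-1)%N.
Proof. by rewrite -subn1 -eqn_mod_dvd ?prime_gt0 //; apply/eqP. Qed.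

Lemma ndvdn_prime_order : ~~ (p %| n)%N.
Proof.
apply/negP=> /dvdn_trans/(_ dvdn_pred_prime)/dvdn_leq.
by rewrite -subn1 subn_gt0 prime_gt1 // leq_subRL ?prime_gt0 // add1n ltnn => /(_ isT).
Qed.

Let iz : ringInt F z.
Proof. by apply: (@ringInt_root _ _ _ n 1) => //; rewrite ?memv_adjoin ?prim_expr_order. Qed.

(** As [p] is 1 modulo [n], [z^p = z], so the cyclotomic congruence applies to the identity; [n]
    cancels because [p] does not divide it. *)
Lemma residue_expp x : ringInt F x -> P (x ^+ p - x).
Proof.
move=> ix; have zp : (1 : gal_of F)%g z = z ^+ p.
  by rewrite gal_id -(prim_expr_mod prim_z p) pn1 prim_expr_mod.
have [y iy xy] := prim_root_frobenius_congr prim_z p_pr zp ix.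
rewrite gal_id in xy; apply: (prime_idealBC P_pr).
have [_ [_ _ Ppr _]] := P_pr.
have [||| /(prime_ideal_natP P_pr p_pr Pp)|//] := Ppr n%:R (x - x ^+ p).
- exact: ringInt_nat.
- exact/ringIntB/ringIntX.
- by rewrite xy; apply: (prime_ideal_natM P_pr Pp).
by rewrite (negPf ndvdn_prime_order).
Qed.

Lemma residue_congr_nat x : ringInt F x -> exists k : nat, P (x - k%:R).
Proof. by move=> ix; apply: (prime_ideal_expp_congr P_pr p_pr Pp ix); apply: residue_expp. Qed.

Lemma residue_card_eq_prime q : residue_card F P q -> q = p.
Proof.
move=> cq; apply: (residue_card_uniq P_pr cq).
apply: (residue_card_prime P_pr p_pr Pp) => x /residue_congr_nat[k].
by exists k.
Qed.

(** If [w = z^m] differs from 1, the sum of its first [n] powers is 0, yet each power is congruent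
    to 1; then [n] lies in [P], so [p] divides [n]. *)
Lemma prim_root_residue_inj m : P (z ^+ m - 1) -> z ^+ m = 1.
Proof.
set w := z ^+ m => Pw; apply/eqP; apply: contraNT ndvdn_prime_order => w1.
have wn : w ^+ n = 1 by rewrite exprAC (prim_expr_order prim_z) expr1n.
apply/(prime_ideal_natP P_pr p_pr Pp); have [[_ P0 PD PN] _] := P_pr.
have -> : n%:R = - \sum_(i < n) (w ^+ i - 1 ^+ i).
  rewrite sumrB sum_unity_root_expr // (negPf w1) sub0r opprK.
  by under eq_bigr do rewrite expr1n; rewrite sumr_const card_ord.
apply: PN; apply: (big_ind P) => // i _.
by apply: (prime_idealXB P_pr) => //; [exact: ringIntX | exact: (ringInt_int F 1)].
Qed.

Lemma prim_root_residue (c : nat) : P (z - c%:R) -> n.-primitive_root (c%:R : 'F_p).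
Proof.
move=> Pc; have ic : ringInt F c%:R by exact: ringInt_nat.
have cX j : P (z ^+ j - (c ^ j)%:R).
  by rewrite natrX; apply: (prime_idealXB P_pr).
have c1 j : (c%:R : 'F_p) ^+ j = 1 <-> z ^+ j = 1.
  split=> [cj | zj].
    apply: prim_root_residue_inj; apply: (prime_ideal_trans P_pr (cX j)).
    by apply/(prime_ideal_natBP P_pr p_pr Pp (c ^ j) 1); rewrite natrX cj.
  rewrite -natrX; apply/(prime_ideal_natBP P_pr p_pr Pp (c ^ j) 1).
  by apply: (prime_idealBC P_pr); have := cX j; rewrite zj.
have [|m prim_c mn] := prim_order_exists n_gt0 (z := c%:R : 'F_p).
  by apply/c1/prim_expr_order.
suff nm : (n %| m)%N by have /eqP-> : n == m by rewrite eqn_dvd nm mn.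
by rewrite (prim_order_dvd prim_z); apply/eqP/c1/prim_expr_order.
Qed.

End ResidueField.

(** * Frobenius elements of subfields of Q(zeta_p) *)

Lemma frobenius_prime_cyclotomic (L : splittingFieldType rat) p l (z : L)
    (K : {subfield L}) (Q : L -> Prop) (s : gal_of <<1; z>>) (t : gal_of K) :
    prime p -> p.-primitive_root z -> prime l -> l <> p ->
    (K <= <<1; z>>)%VS -> t \in 'Gal(K / 1)%g -> {in K, t =1 s} -> s z = z ^+ l ->
    prime_ideal K Q -> Q l%:R ->
  is_frobenius K 1%VS Q t.
Proof.
move=> p_pr prim_z l_pr lp sKM Gt ts sz Q_pr Ql; split=> //; exists l; split.
  apply: (residue_card_prime Q_pr l_pr Ql (K := 1%AS)) => x /ringInt1P[m ->].
  by exists m; rewrite subrr; case: Q_pr => -[].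
move=> x ix; have Kx : x \in K by case: ix.
have ixM := ringIntS (K := <<1; z>>%AS) sKM ix.
have [y [_ iy] xy] := prim_root_frobenius_congr prim_z l_pr sz ixM.
have itx : ringInt K (t x - x ^+ l) by apply: ringIntB; [exact: ringInt_gal | exact: ringIntX].
have l_neq0 : l%:R != 0 :> L by rewrite natr_L_eq0 -lt0n prime_gt0.
rewrite -ts // in xy.
(* The congruence was obtained in Q(zeta_p), while [Q] is an ideal of the integers of [K]; [y]
   descends to [K] as a quotient of elements of [K]. *)
have iyK : ringInt K y.
  split=> //; rewrite -[y](mulKf l_neq0) -xy; case: itx => itx _.
  by rewrite !rpredM ?rpredV ?rpred_nat.
have [_ [_ _ Qpr _]] := Q_pr.
have [||| /(prime_ideal_natP Q_pr l_pr Ql)|//] := Qpr p%:R (t x - x ^+ l) => //.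
- exact: ringInt_nat.
- by rewrite xy; apply: (prime_ideal_natM Q_pr Ql).
by rewrite dvdn_prime2 // => /eqP.
Qed.

(** * Comparison of the Frobenius at [p] with those at the [l i] *)

Theorem theorem3p11
  (n p s : nat) (l : 'I_s -> nat) (a : 'I_s -> nat)
  (Hn : (1 <= n)%N) (Hp : prime p) (Hpn : (p = 1 %[mod n])%N)
  (Hl : forall i, prime (l i)) (Hlinj : injective l)
  (Hlp : forall i, l i <> p) (Hln : forall i, ~~ (l i %| n)%N)
  (Omega : splittingFieldType rat)
  (z zp : Omega) (r : 'I_s -> Omega)
  (Hz : n.-primitive_root z) (Hzp : p.-primitive_root zp)
  (Hr : forall i, r i ^+ n = (l i)%:R)
  (lam : 'I_s -> gal_of <<1%VS & z :: map r (enum 'I_s)>>%VS)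
  (Hlam : forall i, lam i \in 'Gal(<<1%VS & z :: map r (enum 'I_s)>>%VS / <<1%VS; z>>%VS)%g)
  (Hlamr : forall i j, lam i (r j) = if j == i then z * r j else r j)
  (Pf : Omega -> Prop) (HPf : prime_ideal <<1%VS; z>>%VS Pf) (HPfp : Pf (p%:R))
  (HFrob : exists PL : Omega -> Prop,
      [/\ prime_ideal <<1%VS & z :: map r (enum 'I_s)>>%VS PL,
          lies_over <<1%VS; z>>%VS PL Pf &
          is_frobenius <<1%VS & z :: map r (enum 'I_s)>>%VS <<1%VS; z>>%VS PL
            (\prod_(i < s) (lam i ^+ a i))%g])
  (K : {subfield Omega}) (HK : (K <= <<1%VS; zp>>)%VS) (HKdim : \dim K = n) :
  exists2 tau : gal_of K, generator 'Gal(K / 1%VS)%g tau &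
    forall i (Q : Omega -> Prop), prime_ideal K Q -> Q ((l i)%:R) ->
      is_frobenius K 1%VS Q (tau ^+ a i)%g.
Proof.
set E := <<1%VS & z :: map r (enum 'I_s)>>%AS in lam Hlam Hlamr HFrob.
have sFE : (<<1; z>> <= E)%VS.
  apply/FadjoinP; split; first exact: subv_adjoin_seq.
  by apply: seqv_sub_adjoin; rewrite mem_head.
have Er i : r i \in E.
  by apply: seqv_sub_adjoin; rewrite inE map_f ?orbT ?mem_enum.
have iz : ringInt <<1; z>>%AS z.
  by apply: (@ringInt_root _ _ _ n 1) => //; rewrite ?memv_adjoin ?prim_expr_order.
pose d := (p.-1 %/ n)%N.
have pdn : p.-1 = (d * n)%N by rewrite divnK ?dvdn_pred_prime.
have p_l i : ~~ (p %| l i)%N by rewrite dvdn_prime2 // eq_sym; apply/eqP.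
have [c Pc] := residue_congr_nat Hp Hpn Hz HPf HPfp iz.
have prim_c := prim_root_residue Hn Hp Hpn Hz HPf HPfp Pc.
have lc i : (l i)%:R ^+ d = c%:R ^+ a i :> 'F_p.
  have [PL [PL_pr PLF [_ [q [resq Frob]]]]] := HFrob.
  have iri : ringInt E (r i) by apply: (ringInt_root Hn _ (Hr i)).
  have izE : ringInt E z by apply: ringIntS iz.
  have PLp : PL p%:R by apply/PLF => //; exact: ringInt_nat.
  (* [PL] and [Pf] agree on integers of [F], so the representatives counted modulo [PL] also form a
     system modulo [Pf]. *)
  have qp : q = p.
    apply: (residue_card_eq_prime Hp Hpn Hz HPf HPfp).
    case: resq => t [sz_t tF t_inj tP]; exists t; split=> // [j k ltj ltk Pjk|x ix].
      apply: t_inj => //; apply/PLF => //; apply: ringIntB; apply: tF.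
        by rewrite mem_nth ?sz_t.
      by rewrite mem_nth ?sz_t.
    have [y ty Pxy] := tP x ix; exists y => //; apply/PLF => //.
    by apply: ringIntB => //; apply: tF.
  have := Frob _ iri; rewrite (gal_prod_kummer a sFE _ Er Hlam Hlamr) ?memv_adjoin // qp.
  have -> : r i ^+ p = (l i)%:R ^+ d * r i.
    by rewrite -Hr -exprM mulnC -pdn -exprSr prednK ?prime_gt0.
  rewrite -mulrBl.
  have [_ [_ _ PLpr _]] := PL_pr.
  have izl (F' : {subfield Omega}) : ringInt F' z -> ringInt F' (z ^+ a i - (l i)%:R ^+ d).
    by move=> ?; apply: ringIntB; apply: ringIntX => //; exact: ringInt_nat.
  (* The Frobenius congruence at [r i] has become [(z^(a i) - (l i)^d) * r i] in [PL]. The second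
     factor is not in [PL], since otherwise [l i = (r i)^n] would be and [p] would divide [l i]. *)
  case/(PLpr _ _ (izl _ izE) iri) => [/(PLF _ (izl _ iz)) Pza | Pr].
    rewrite -!natrX; apply/(prime_ideal_natBP HPf Hp HPfp); rewrite !natrX.
    apply: (prime_ideal_trans HPf (prime_idealBC HPf Pza)).
    by apply: (prime_idealXB HPf) => //; exact: ringInt_nat.
  have /negP[] := p_l i; apply/(prime_ideal_natP PL_pr Hp PLp).
  have [_ [PLM _ _ _]] := PL_pr.
  by rewrite -Hr -(prednK Hn) exprSr; apply: PLM => //; exact: ringIntX.
have [k0 k0c] := Fp_unity_root_expr Hp pdn Hn (prim_expr_order prim_c).
have pk0 : ~~ (p %| k0)%N.
  rewrite -natr_Fp_eq0 //; apply/eqP=> k00.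
  have /eqP := prim_expr_order prim_c; rewrite -k0c -exprM -pdn k00 expr0n.
  by rewrite -subn1 subn_eq0 leqNgt prime_gt1 // eq_sym oner_eq0.
have [s0 Gs0 s0z] := gal_prime_prim_root_exists Hp Hzp pk0.
have galK := galois_sub_prime_cyclotomic Hp Hzp HK.
have [tau Gtau tau_s0] := gal_restrict HK galK Gs0.
(* [tau^j] is the restriction of [zp |-> zp^(k0^j)], and [(k0^j)^d = c^j], so comparing [d]-th
   powers of exponents suffices. This serves both for generation and for the Frobenius elements. *)
have eq_in (sg : gal_of <<1; zp>>) (k j : nat) : sg \in 'Gal(<<1; zp>> / 1)%g ->
    sg zp = zp ^+ k -> k%:R ^+ d = c%:R ^+ j :> 'F_p -> {in K, (tau ^+ j)%g =1 sg}.
  move=> Gsg sgz kd x Kx; rewrite (gal_expg_eq_in j HK tau_s0) //.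
  apply: (gal_prime_prim_root_eq_in Hp Hzp HK (groupX j Gs0) Gsg
    (galX_prime_prim_root j s0z) sgz) => //.
  by rewrite HKdim natrX exprAC k0c.
exists tau.
  rewrite /generator eqEsubset cycle_subG Gtau andbT; apply/subsetP=> t Gt.
  have [sg Gsg tsg] : exists2 sg, sg \in 'Gal(<<1; zp>> / 1)%g & {in K, t =1 sg}.
    have /and3P[_ _ nM] := galois_adjoin_prim_root Hzp.
    have := Gt; rewrite gal_kHom ?sub1v // => /kHom_to_gal tK.
    by have [|//|sg Gsg] := tK <<1; zp>>%AS; [rewrite sub1v HK | exists sg].
  have [k pk sgz] := gal_prime_prim_rootP Hp Hzp sg.
  (* [k^d] is an [n]-th root of unity in F_p because [d n = p - 1], hence a power of [c]. *)
  have [|j kj] := prim_rootP prim_c (x := k%:R ^+ d).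
    by rewrite -exprM -pdn Fp_expr_pred ?natr_Fp_eq0.
  apply/cycleP; exists j; apply/eqP/gal_eqP=> x Kx.
  by rewrite tsg // (eq_in _ _ _ Gsg sgz kj).
move=> i Q Q_pr Ql.
have [sg Gsg sgz] := gal_prime_prim_root_exists Hp Hzp (p_l i).
apply: (frobenius_prime_cyclotomic Hp Hzp (Hl i) (Hlp i) HK _ _ sgz Q_pr Ql).
  by rewrite groupX.
exact: eq_in Gsg sgz (lc i).
Qed.
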